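(* Denote $q_{\max}=\max_{n\in\mathbb{N}} q_n$. If $\mathbb{E} Z=\infty$, then there exists a constant $c\in[e^{-1/(1-q_{\max})},\,e^{-1}]$ such that $$\lim_{n\to\infty}\frac{\mathbb{E} L_n}{R_n^{(0)}}=c.$$
   Context: $\mathbb{N}=\{1,2,\ldots\}$. Let $Z,Z_1,Z_2,\ldots$ be independent, identically distributed random variables taking values in $\mathbb{N}$; write $q_n=\mathbb{P}\{Z=n\}$ for $n\in\mathbb{N}$. The coloring $(C_n)_{n\in\mathbb{Z}}$ is defined by $C_i=i$ for all integers $i\le 0$ and $C_n=C_{n-Z_n}$ for $n\in\mathbb{N}$. In the associated forest on $\mathbb{Z}$, each $i\le 0$ is the root of a tree, and each $n\in\mathbb{N}$ is attached to its parent $n-Z_n$. $L_n$ is the number of leaves at time $n$ of the tree rooted at $0$: the number of $t\in\{1,\ldots,n\}$ such that $C_t=0$ and no $s\in\{t+1,\ldots,n\}$ satisfies $s-Z_s=t$. Further, $r_t=\mathbb{P}\{C_t=0\}$ and $R_n^{(0)}=\sum_{t=1}^n r_t$ is the expected size at time $n$ of the tree rooted at $0$. *)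

(* Defs.v *)
From HB Require Import structures.
From mathcomp Require Import all_boot all_order all_algebra finmap.
From mathcomp Require Import all_classical all_reals all_analysis.
From mathcomp Require Import zify.

Set Implicit Arguments.
Unset Strict Implicit.
Unset Printing Implicit Defensive.

Import Order.TTheory GRing.Theory Num.Theory.
Import numFieldNormedType.Exports.

Local Open Scope classical_set_scope.
Local Open Scope ring_scope.

(* The coloring attached to a sequence z of jumps: color i = i for i <= 0 and
   color n = color (n - z n) for n >= 1; see coloring_le0 and coloring_gt0.
   The recursion follows the parents for at most k steps. When all jumps are
   positive, `|i| steps suffice to reach a nonpositive integer from i. *)
Fixpoint coloring_rec (z : nat -> nat) (k : nat) (i : int) : int :=
  match k, i with
  | k'.+1, Posz (n.+1) => coloring_rec z k' (n.+1%:Z - (z n.+1)%:Z)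
  | _, _ => i
  end.

Definition coloring (z : nat -> nat) (i : int) : int :=
  coloring_rec z `|i|%N i.

Lemma coloring_rec_le0 z k i : i <= 0 -> coloring_rec z k i = i.
Proof. by case: k => [//|k]; case: i => [[|n]|n]. Qed.

Lemma coloring_le0 z i : i <= 0 -> coloring z i = i.
Proof. exact: coloring_rec_le0. Qed.

Lemma coloring_rec_fuel z k l i : (forall n, (0 < n)%N -> (0 < z n)%N) ->
  i <= k%:Z -> i <= l%:Z -> coloring_rec z k i = coloring_rec z l i.
Proof.
move=> z0; elim: k l i => [|k IH] l i ik il.
  by rewrite !coloring_rec_le0.
have [i0|i0] := leP i 0; first by rewrite !coloring_rec_le0.
case: l il => [|l] il; first by lia.
case: i ik il i0 => [[|n]|n] // ik il _ /=.
by apply: IH; have := z0 n.+1 isT; lia.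
Qed.

Lemma coloring_gt0 z n : (forall n, (0 < n)%N -> (0 < z n)%N) ->
  (0 < n)%N -> coloring z n%:Z = coloring z (n%:Z - (z n)%:Z).
Proof.
move=> z0; case: n => [//|n] _; rewrite /coloring /=.
by apply: coloring_rec_fuel => //; have := z0 n.+1 isT; lia.
Qed.

Definition num_leaves (z : nat -> nat) (n : nat) : nat :=
  #|[set t : 'I_n.+1 | [&& (0 < t)%N, coloring z (t : nat)%:Z == 0 &
      [forall s : 'I_n.+1, (t < s)%N ==>
        ((s : nat)%:Z - (z s)%:Z != (t : nat)%:Z)]]]|.

Section random.
Context (d : measure_display) (T : measurableType d) (R : realType).
Variable P : probability T R.

(* Mutual independence: the product rule over every finite subfamily. *)
Definition mutually_independent (I : choiceType) (d' : measure_display)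
    (E : measurableType d') (X : I -> {RV P >-> E}) : Prop :=
  forall (J : {fset I}) (B : I -> set E),
    (forall i, measurable (B i)) ->
    P (\bigcap_(i in [set` J]) (X i @^-1` B i)) =
      (\prod_(i <- J) P (X i @^-1` B i))%E.

Definition identically_distributed (I : Type) (d' : measure_display)
    (E : measurableType d') (X : I -> {RV P >-> E}) : Prop :=
  forall (i j : I) (B : set E), measurable B ->
    distribution P (X i) B = distribution P (X j) B.

Definition prob_eq (X : {RV P >-> nat}) (n : nat) : R :=
  fine (P (X @^-1` [set n])).

(* The maximum of the point masses at n >= 1. The supremum is attained, see
   qmax_attained. *)
Definition qmax (X : {RV P >-> nat}) : R :=
  sup [set prob_eq X n | n in [set n | (0 < n)%N]].

Variable Z : nat -> {RV P >-> nat}.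

Definition leaves (n : nat) (w : T) : nat := num_leaves (fun k => Z k w) n.

Definition root0_prob (t : nat) : \bar R :=
  P [set w | coloring (fun k => Z k w) t%:Z = 0].

Definition mean_size (n : nat) : \bar R :=
  (\sum_(1 <= t < n.+1) root0_prob t)%E.

End random.

Lemma measurable_RV_nat (d : measure_display) (T : measurableType d)
    (R : realType) (P : probability T R) (X : {RV P >-> nat}) (A : set nat) :
  measurable (X @^-1` A).
Proof. by rewrite -[_ @^-1` _]setTI; exact: measurable_funP. Qed.

Lemma qmax_attained (d : measure_display) (T : measurableType d)
    (R : realType) (P : probability T R) (X : {RV P >-> nat}) :
  (forall w, (0 < X w)%N) ->
  (exists2 n, (0 < n)%N & prob_eq X n = qmax X) /\
  (forall n, (0 < n)%N -> prob_eq X n <= qmax X).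
Proof.
move=> X0; set A := [set prob_eq X n | n in [set n | (0 < n)%N]].
have qfin n : P (X @^-1` [set n]) = (prob_eq X n)%:E.
  by rewrite fineK// fin_num_measure//; exact: measurable_RV_nat.
have supA : has_sup A.
  split; first by exists (prob_eq X 1), 1%N.
  exists 1 => _ [n _ <-]; rewrite -lee_fin -qfin.
  by apply: probability_le1; exact: measurable_RV_nat.
have leq n : (0 < n)%N -> prob_eq X n <= qmax X.
  by move=> n0; apply: ub_le_sup; [exact: supA.2 | exists n].
split=> //.
have q_ge0 n : 0 <= prob_eq X n by rewrite fine_ge0.
pose F n := X @^-1` [set k | (n <= k)%N].
have F0 : \bigcap_n F n = set0.
  by apply/seteqP; split=> // w /(_ (X w).+1 I); rewrite /F /= ltnn.
have FP : P \o F @ \oo --> 0%E.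
  rewrite -(measure0 P) -F0; apply: nonincreasing_cvg_mu.
  - by rewrite (le_lt_trans (probability_le1 _ _)) ?ltry//;
      exact: measurable_RV_nat.
  - by move=> i; exact: measurable_RV_nat.
  - by rewrite F0.
  - by move=> m n mn; apply/subsetPset => w; apply: leq_trans.
have qF k n : (k <= n)%N -> ((prob_eq X n)%:E <= P (F k))%E.
  move=> kn; rewrite -qfin; apply: le_measure; rewrite ?inE;
    try exact: measurable_RV_nat.
  move=> w Xw; have Xn : X w = n := Xw.
  by suff: (k <= X w)%N by []; rewrite Xn.
have [s0|s0] := leP (qmax X) 0.
  by exists 1%N => //; apply/eqP; rewrite eq_le leq//= (le_trans s0).
have [N _ FN] : \forall n \near \oo, (P (F n) < (qmax X / 2)%:E)%E.
  apply: (FP [set x | x < (qmax X / 2)%:E]%E).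
  by apply: open_ereal_lt'; rewrite lte_fin divr_gt0.
have small n : (N <= n)%N -> prob_eq X n < qmax X / 2.
  by move=> Nn; rewrite -lte_fin (le_lt_trans (qF N n Nn))//; apply: FN => /=.
pose M := [arg max_(i > (ord0 : 'I_N.+1)) prob_eq X i.+1]%O.
exists M.+1 => //; apply/eqP; rewrite eq_le leq//=.
have le2 : qmax X <= Num.max (prob_eq X M.+1) (qmax X / 2).
  apply: ge_sup; first exact: supA.1.
  move=> _ [[//|n] _ <-]; rewrite le_max.
  have [nN|Nn] := ltnP n N.+1; last by rewrite (ltW (small _ _)) ?orbT//; lia.
  rewrite /M; case: arg_maxP => //= i _ /(_ (Ordinal nN) isT) /= h.
  by apply/orP; left.
move: le2; rewrite le_max => /orP[//|].
by rewrite ler_pdivlMr// ger_pMr// leNgt ltr1n.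
Qed.

(* Main.v *)
Require Import Defs.
From HB Require Import structures.
From mathcomp Require Import all_boot all_order all_algebra finmap.
From mathcomp Require Import all_classical all_reals all_analysis.
From mathcomp Require Import measurable_realfun.
From mathcomp Require Import zify ring lra.

Set Implicit Arguments.
Unset Strict Implicit.
Unset Printing Implicit Defensive.

Import Order.TTheory GRing.Theory Num.Theory.
Import numFieldNormedType.Exports.

Local Open Scope classical_set_scope.
Local Open Scope ring_scope.

(** Write r t for the probability that t has color 0, and q j for the
probability of a jump j. The color of t is a function of the jumps at times at
most t, whereas t is still a leaf at time n when the jumps at the later times
s <= n avoid the values s - t. By independence t contributes
r t * \prod_(1 <= j <= n - t) (1 - q j) to the expected number of leaves, while
it contributes r t to the expected size of the tree. The ratio is therefore an
average, with weights r t, of the partial products p (n - t) of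
\prod_j (1 - q j).

The partial products decrease to a limit c. From
exp (- x / (1 - s)) <= 1 - x <= exp (- x) for 0 <= x <= s < 1 and from
\sum_j q j = 1 one gets the two bounds on c, with s = qmax
([cvg_prod_1B]). Here qmax < 1, for otherwise the jump would be almost surely
constant and would have a finite mean ([qmax_lt1]).

The weighted average tends to c as soon as the total weight diverges, because
the weights are bounded and only the last few of them meet values p m
away from c ([cvg_weighted_mean]). For the divergence, conditioning on the
parent gives the renewal equation
r t = \sum_(k < t) r k * q (t - k) ([root0_renewal]). So r k is the
probability that the random walk from 0 with steps distributed as the jumps
visits k. As this walk has a last visited site in [0, n], the sum over k <= n of
r k times the probability of a jump larger than n - k equals 1
([renewal_mass]). Long jumps have small probability, so such an identity for
every n forces \sum_k r k to be infinite ([renewal_cvg_pinfty]). *)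

(** * Renewal sequences *)

(** When q is the law of the steps of a walk started at 0, and a m is the
probability that a step exceeds m, the k-th summand is the probability that k
is the last site in [0, n] that the walk visits. The proof is an induction on
n, where each tail a (n + 1 - k) loses exactly the terms that the renewal
equation collects in r (n + 1). *)
Lemma renewal_mass (R : realType) (q a r : R^nat) (n : nat) :
  a 0%N = 1 -> (forall m, a m.+1 = a m - q m.+1) -> r 0%N = 1 ->
  (forall t, r t.+1 = \sum_(k < t.+1) r k * q (t.+1 - k)%N) ->
  \sum_(k < n.+1) r k * a (n - k)%N = 1.
Proof.
move=> a0 aS r0 rS; elim: n => [|n IH]; first by rewrite big_ord1 r0 a0 mulr1.
rewrite big_ord_recr /= subnn a0 mulr1 rS -big_split -[RHS]IH.
apply: eq_bigr => k _ /=.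
rewrite subSn ?aS; last by rewrite -ltnS.
by rewrite mulrBr subrK.
Qed.

(** Summing [renewal_mass] over the horizons below N bounds N by the product of
\sum_(k < N) r k and \sum_(j < N) a j; the second factor is o(N), by Cesaro's
theorem, so the first one diverges. *)
Lemma renewal_cvg_pinfty (R : realType) (q a r : R^nat) :
  a 0%N = 1 -> (forall m, a m.+1 = a m - q m.+1) -> r 0%N = 1 ->
  (forall t, r t.+1 = \sum_(k < t.+1) r k * q (t.+1 - k)%N) ->
  (forall t, 0 <= r t) -> (forall m, 0 <= a m) -> a @ \oo --> (0 : R) ->
  \sum_(k < n.+1) r k @[n --> \oo] --> +oo.
Proof.
move=> a0 aS r0 rS r_ge0 a_ge0 a_cvg0.
pose A m := \sum_(j < m) a j.
(* The sum of the identities of [renewal_mass] over the horizons n < N. *)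
have mass N : \sum_(k < N) r k * A (N - k)%N = N%:R.
  elim: N => [|N IH]; first by rewrite big_ord0.
  rewrite -natr1 -[X in _ + X](renewal_mass N a0 aS r0 rS) -IH.
  rewrite big_ord_recr [X in _ = _ + X]big_ord_recr /= subnn addrA.
  rewrite -big_split /=; congr (_ + _).
    apply: eq_bigr => k _; rewrite -mulrDr subSn; last exact: ltnW.
    by rewrite /A big_ord_recr.
  by rewrite subSnn /A big_ord1.
have A_le m l : (m <= l)%N -> A m <= A l.
  by move=> /subnKC <-; rewrite /A big_split_ord lerDl sumr_ge0.
have bound n : n.+1%:R <= (\sum_(k < n.+1) r k) * A n.+1.
  rewrite -mass mulr_suml; apply: ler_sum => k _; apply: ler_wpM2l => //.
  exact/A_le/leq_subr.
have := cesaro a_cvg0; move=> mean0; apply/cvgryPge => K.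
have [K0|K0] := leP K 0.
  by near=> n; rewrite (le_trans K0)// sumr_ge0.
near=> n.
have : arithmetic_mean a n <= K^-1.
  by near: n; apply: (cvgr_le _ mean0); rewrite invr_gt0.
rewrite /arithmetic_mean /= /series /= big_mkord -/(A n.+1) => meanK.
have AK : A n.+1 <= n.+1%:R / K by rewrite -ler_pdivrMl ?ltr0n.
have nK0 : 0 < n.+1%:R / K by rewrite divr_gt0.
rewrite -(ler_pM2r nK0) mulrCA divff ?gt_eqF// mulr1.
by rewrite (le_trans (bound n))// ler_wpM2l// sumr_ge0.
Unshelve. all: end_near. Qed.

(** * Weighted means and infinite products *)

Lemma cvg_weighted_mean (R : realType) (r p : R^nat) (c : R) :
  (forall t, 0 <= r t <= 1) -> \sum_(t < n) r t @[n --> \oo] --> +oo ->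
  p @ \oo --> c ->
  (\sum_(t < n) r t * p (n - t.+1)%N) / (\sum_(t < n) r t) @[n --> \oo] --> c.
Proof.
move=> r01 Soo pc; apply/cvgrPdist_le => e e0.
have e20 : 0 < e / 2 by rewrite divr_gt0.
have [M _ pM] : \forall m \near \oo, `|c - p m| <= e / 2.
  by move/cvgrPdist_le : pc; apply.
pose D := \sum_(m < M) `|c - p m|.
near=> n.
have S0 : 0 < \sum_(t < n) r t by near: n; move/cvgryPgt : Soo; apply.
have SD : D / (e / 2) <= \sum_(t < n) r t.
  by near: n; move/cvgryPge : Soo; apply.
set S := \sum_(t < n) r t in S0 SD *.
rewrite -[c](mulfK (lt0r_neq0 S0)) -mulrBl normrM normfV (gtr0_norm S0).
rewrite ler_pdivrMr// mulr_sumr -sumrB.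
under eq_bigr do rewrite [c * _]mulrC -mulrBr.
apply: (le_trans (ler_norm_sum _ _ _)).
(* The deviation c - p m is at most e / 2 except for m < M; the deviations for
   m < M are met by at most M weights, each at most 1, so that they add up to at
   most D for every n. *)
pose b m := if (m < M)%N then `|c - p m| else 0.
have split_bound t : `|r t * (c - p (n - t.+1)%N)|
    <= e / 2 * r t + b (n - t.+1)%N.
  have /andP[rt0 rt1] := r01 t.
  rewrite normrM ger0_norm// /b; case: ltnP => [_|Mn].
    by rewrite ler_wpDl ?ler_piMl// mulr_ge0// ltW.
  by rewrite addr0 mulrC ler_wpM2r//; apply: pM.
apply: (le_trans (ler_sum _ (fun t _ => split_bound _))).
rewrite big_split /= -mulr_sumr -/S.
have -> : \sum_(t < n) b (n - t.+1)%N = \sum_(m < n) b m.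
  by rewrite [RHS](reindex_inj rev_ord_inj).
have bD : \sum_(m < n) b m <= D.
  apply: (@le_trans _ _ (\sum_(m < n + M) b m)).
    rewrite big_split_ord lerDl sumr_ge0// => m _.
    by rewrite /b; case: ifP.
  rewrite addnC big_split_ord /= [X in _ + X]big1 => [|m _].
    by rewrite addr0; apply: ler_sum => m _; rewrite /b ltn_ord.
  by rewrite /b ltnNge leq_addr.
move: SD; rewrite ler_pdivrMr// => SD; lra.
Unshelve. all: end_near. Qed.

(** Inverting 1 + y <= exp y at y = x / (1 - x) gives
exp (- x / (1 - x)) <= 1 - x, and x / (1 - x) <= x / (1 - s). *)
Lemma expR_le_1B (R : realType) (x s : R) :
  0 <= x -> x <= s -> s < 1 -> expR (- (x / (1 - s))) <= 1 - x.
Proof.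
move=> x0 xs s1; have x1 : 0 < 1 - x by lra.
have inv1 : (1 - x)^-1 = 1 + x / (1 - x) by field; rewrite lt0r_neq0.
have e1 : (1 - x)^-1 <= expR (x / (1 - x)).
  by rewrite [leLHS]inv1 expR_ge1Dx.
rewrite expRN -[leRHS]invrK lef_pV2 ?posrE ?expR_gt0 ?invr_gt0//.
rewrite (le_trans e1)// ler_expR ler_wpM2l// lef_pV2 ?posrE; lra.
Qed.

Lemma cvg_prod_1B (R : realType) (q : R^nat) (s l : R) :
  s < 1 -> (forall j, 0 <= q j <= s) -> series q @ \oo --> l ->
  exists c : R, expR (- (l / (1 - s))) <= c <= expR (- l) /\
    \prod_(j < m) (1 - q j) @[m --> \oo] --> c.
Proof.
move=> s1 q0s ql; pose p m := \prod_(j < m) (1 - q j).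
have q0 j : 0 <= q j by have /andP[] := q0s j.
have qs j : q j <= s by have /andP[] := q0s j.
have p0 m : 0 <= p m.
  by apply: prodr_ge0 => j _; have := qs j; lra.
have p_dec : nonincreasing_seq p.
  apply/nonincreasing_seqP => m; rewrite /p big_ord_recr /=.
  by rewrite ler_piMr//; [exact: p0 | have := q0 m; lra].
have p_cvg : cvgn p.
  by apply: nonincreasing_is_cvgn => //; exists 0 => _ [m _ <-].
have p_lb m : expR (- (series q m / (1 - s))) <= p m.
  rewrite /series /= big_mkord mulr_suml -sumrN expR_sum.
  by apply: ler_prod => j _; rewrite expR_ge0 expR_le_1B.
have p_ub m : p m <= expR (- series q m).
  rewrite /series /= big_mkord -sumrN expR_sum.
  apply: ler_prod => j _; rewrite (le_trans _ (expR_ge1Dx _))// andbT.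
  by have := qs j; lra.
exists (limn p); split; last exact: p_cvg.
apply/andP; split.
  have cvg_lb : expR (- (series q m / (1 - s))) @[m --> \oo] -->
      expR (- (l / (1 - s))).
    apply: continuous_cvg; first exact: continuous_expR.
    by apply: cvgN; apply: cvgMl.
  apply: (ler_cvg_to cvg_lb p_cvg); near=> m; exact: p_lb.
have cvg_ub : expR (- series q m) @[m --> \oo] --> expR (- l).
  apply: continuous_cvg; first exact: continuous_expR.
  exact: cvgN.
apply: (ler_cvg_to p_cvg cvg_ub); near=> m; exact: p_ub.
Unshelve. all: end_near. Qed.

(** * Independence of a color from the later jumps *)

Section jumps.
Context (d : measure_display) (T : measurableType d) (R : realType).
Context (P : probability T R) (Z : nat -> {RV P >-> nat}).
Context (Zpos : forall n w, (0 < Z n w)%N).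

Definition root0 (t : nat) : set T :=
  [set w | coloring (fun k => Z k w) t%:Z = 0].

Definition jumps_in (t n : nat) (B : nat -> set nat) : set T :=
  \bigcap_(s in [set s | (t < s <= n)%N]) Z s @^-1` B s.

(** A jump longer than t leads to a negative parent, which is the root of another
tree. *)
Lemma root0_parent t w : (0 < t)%N ->
  root0 t w <-> (Z t w <= t)%N /\ root0 (t - Z t w) w.
Proof.
move=> t0; rewrite /root0 /= coloring_gt0//.
have [Zt|tZ] := leqP (Z t w) t.
  by rewrite subzn//; split => [|[]].
rewrite coloring_le0; last by lia.
by split => [|[]//]; lia.
Qed.

Lemma root0_0 : root0 0 = setT.
Proof. by apply/seteqP; split. Qed.

Lemma root0S t : root0 t.+1 =
  \big[setU/set0]_(k < t.+1) (root0 k `&` Z t.+1 @^-1` [set (t.+1 - k)%N]).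
Proof.
rewrite -(bigcup_mkord t.+1
  (fun k => root0 k `&` Z t.+1 @^-1` [set (t.+1 - k)%N])).
apply/seteqP; split => w.
  move=> /root0_parent -/(_ isT)[Zt rt]; exists (t.+1 - Z t.+1 w)%N => /=.
    by have := Zpos t.+1 w; lia.
  by split=> //; rewrite subKn.
move=> [k /= kt [rk Zk]]; apply/root0_parent => //; rewrite Zk.
by split; [exact: leq_subr | rewrite subKn// ltnW].
Qed.

Lemma measurable_root0 t : measurable (root0 t).
Proof.
elim/ltn_ind: t => -[|t] IH; first by rewrite root0_0.
rewrite root0S; apply: bigsetU_measurable => k _.
by apply: measurableI; [exact: IH | exact: measurable_RV_nat].
Qed.

Lemma measurable_jumps_in t n B : measurable (jumps_in t n B).
Proof.
apply: fin_bigcap_measurable => [|s _]; last exact: measurable_RV_nat.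
by apply: (sub_finite_set _ (finite_II n.+1)) => s /= /andP[].
Qed.

Lemma jumps_in_nil n B : jumps_in n n B = setT.
Proof. by apply/seteqP; split => // w _ s /= /andP[]; lia. Qed.

(** Conditions on the jumps after time k that express that t.+1 is a child of k
and that the jumps after t.+1 satisfy B; the jumps strictly between are free. *)
Let next_conds t k (B : nat -> set nat) (s : nat) : set nat :=
  if (s <= t)%N then setT else if s == t.+1 then [set (t.+1 - k)%N] else B s.

Lemma root0S_jumps_in t n B : (t < n)%N ->
  root0 t.+1 `&` jumps_in t.+1 n B = \big[setU/set0]_(k < t.+1)
    (root0 k `&` jumps_in k n (next_conds t k B)).
Proof.
move=> tn; rewrite root0S big_distrl /=; apply: eq_bigr => k _.
apply/seteqP; split => w.
  move=> [[rk Zk] jB]; split=> // s /= /andP[ks sn].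
  rewrite /next_conds; case: leqP => // ts.
  by case: eqP => [->//|/eqP st]; apply: jB; rewrite /= sn andbT; lia.
move=> [rk jB]; split.
  by split=> //; have := jB t.+1; rewrite /next_conds ltnn eqxx /=; apply;
    have := ltn_ord k; lia.
move=> s /= /andP[ts sn]; have := jB s; rewrite /next_conds.
rewrite leqNgt (ltnW ts) gtn_eqF//=; apply; have := ltn_ord k; lia.
Qed.

Local Open Scope ereal_scope.

(** The events in [root0S_jumps_in] are disjoint in k, as they prescribe
different values of the jump at t.+1, and each of them factors by the
hypothesis at k. *)
Lemma root0_next t n B : (t < n)%N ->
  (forall k C, (k <= t)%N -> P (root0 k `&` jumps_in k n C) =
     P (root0 k) * \prod_(k <= s < n) P (Z s.+1 @^-1` C s.+1)) ->
  P (root0 t.+1 `&` jumps_in t.+1 n B) =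
    (\sum_(k < t.+1) P (root0 k) * P (Z t.+1 @^-1` [set (t.+1 - k)%N])) *
    \prod_(t.+1 <= s < n) P (Z s.+1 @^-1` B s.+1).
Proof.
move=> tn indep; rewrite root0S_jumps_in//.
transitivity (\sum_(k < t.+1)
    P (root0 k `&` jumps_in k n (next_conds t k B))); last first.
  rewrite ge0_sume_distrl => [|k _]; last by rewrite mule_ge0.
  apply: eq_bigr => k _; have kt : (k <= t)%N by rewrite -ltnS.
  rewrite indep// -muleA; congr (_ * _).
  rewrite (big_cat_nat (n := t)) //=; last exact: ltnW.
  rewrite [X in X * _]big_nat_cond [X in X * _]big1 ?mul1e; last first.
    move=> s /andP[/andP[_ st] _].
    by rewrite /next_conds st preimage_setT probability_setT.
  rewrite big_ltn//; congr (_ * _).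
    by rewrite /next_conds ltnn eqxx.
  apply: eq_big_nat => s /andP[ts _].
  by rewrite /next_conds ltnNge ltnW//= gtn_eqF.
apply: measure_semi_additive_ord.
- by move=> k; apply: measurableI;
    [exact: measurable_root0 | exact: measurable_jumps_in].
- apply/trivIsetP => i j _ _ ij; apply/seteqP; split => // w.
  move=> [[_ jBi] [_ jBj]].
  have := jBi t.+1; have := jBj t.+1.
  rewrite /next_conds /= ltnn eqxx tn !ltn_ord /= => /(_ isT) -> /(_ isT) E.
  by move/eqP: ij; apply; apply: val_inj; have := ltn_ord i; have := ltn_ord j;
    move: E => /=; lia.
- by apply: bigsetU_measurable => k _; apply: measurableI;
    [exact: measurable_root0 | exact: measurable_jumps_in].
Qed.

Context (Zindep : mutually_independent Z).

Lemma prob_jumps_in n B : P (jumps_in 0 n B) =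
  \prod_(0 <= s < n) P (Z s.+1 @^-1` B s.+1).
Proof.
pose J : {fset nat} := seq_fset tt (index_iota 1 n.+1).
have -> : jumps_in 0 n B = \bigcap_(s in [set` J]) (Z s @^-1` B s).
  congr bigcap; apply/seteqP; split => s /=.
    by rewrite seq_fsetE mem_index_iota.
  by rewrite seq_fsetE mem_index_iota.
rewrite Zindep// (perm_big _ (seq_fset_perm _ _)) undup_id ?iota_uniq//.
by rewrite big_add1.
Qed.

(** Strong induction on t. At t = 0 the color is deterministic and this is
mutual independence. For t.+1, [root0_next] yields a first factor that
depends neither on n nor on B; its value is P (root0 t.+1), as n = t.+1 shows. *)
Lemma root0_indep t n B : (t <= n)%N ->
  P (root0 t `&` jumps_in t n B) =
    P (root0 t) * \prod_(t <= s < n) P (Z s.+1 @^-1` B s.+1).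
Proof.
elim/ltn_ind: t n B => -[|t] IH n B tn.
  by rewrite root0_0 setTI probability_setT mul1e prob_jumps_in.
have IH' m k C : (t < m)%N -> (k <= t)%N -> P (root0 k `&` jumps_in k m C) =
     P (root0 k) * \prod_(k <= s < m) P (Z s.+1 @^-1` C s.+1).
  by move=> tm kt; apply: IH => //; lia.
rewrite root0_next => [|//|k C kt]; last exact: IH'.
congr (_ * _); rewrite -[in RHS](setIT (root0 t.+1)) -(jumps_in_nil t.+1 B).
by rewrite root0_next => [|//|k C kt]; [rewrite big_geq ?mule1|exact: IH'].
Qed.

Lemma root0_renewal t : P (root0 t.+1) =
  \sum_(k < t.+1) P (root0 k) * P (Z t.+1 @^-1` [set (t.+1 - k)%N]).
Proof.
rewrite -[in LHS](setIT (root0 t.+1)) -(jumps_in_nil t.+1 (fun=> setT)).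
by rewrite root0_next ?big_geq ?mule1// => k C kt; apply: root0_indep; lia.
Qed.

End jumps.

(** * The expected number of leaves *)

Section mean_leaves.
Context (d : measure_display) (T : measurableType d) (R : realType).
Context (P : probability T R) (Z : nat -> {RV P >-> nat}).
Context (Zpos : forall n w, (0 < Z n w)%N).

Local Open Scope ereal_scope.

Definition leaf (t n : nat) : set T :=
  root0 Z t `&` jumps_in Z t n (fun s => ~` [set (s - t)%N]).

Lemma leaves_sum_indic n w :
  (leaves Z n w)%:R = (\sum_(t < n) \1_(leaf t.+1 n) w)%R :> R.
Proof.
rewrite /leaves /num_leaves -sum1_card natr_sum big_mkcond big_ord_recl.
rewrite memNset//= add0r; apply: eq_bigr => t _; rewrite indicE.
set b := _ \in _; suff -> : b = (w \in leaf t.+1 n) by case: (_ \in _).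
apply/idP/idP; rewrite /b !inE /= [bump 0 t]add1n.
  move=> /andP[/eqP rt /forallP noc]; split=> // s /= /andP[ts sn].
  have := noc (Ordinal (sn : (s < n.+1)%N)); rewrite /= ts /= => /eqP.
  move=> ne Zs; apply: ne; rewrite Zs; lia.
move=> [rt noc]; apply/andP; split; first exact/eqP.
apply/forallP => s; apply/implyP => ts; apply/eqP.
have := noc s; rewrite /= ts -ltnS ltn_ord => /(_ isT) ne Zs.
by apply: ne => /=; lia.
Qed.

Lemma measurable_leaf t n : measurable (leaf t n).
Proof.
by apply: measurableI; [exact: measurable_root0 | exact: measurable_jumps_in].
Qed.

Lemma expectation_leaves n :
  'E_P[(fun w => (leaves Z n w)%:R : R)] = \sum_(t < n) P (leaf t.+1 n).
Proof.
rewrite unlock; under eq_integral do rewrite leaves_sum_indic -sumEFin.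
rewrite ge0_integral_sum//=; last first.
  move=> t; apply/measurable_EFinP.
  by apply: measurable_indic; exact: measurable_leaf.
apply: eq_bigr => t _; rewrite integral_indic ?setIT//; exact: measurable_leaf.
Qed.

Context (Zindep : mutually_independent Z).
Context (Zid : identically_distributed Z).

Local Notation q := (prob_eq (Z 0%N)).
Local Notation r t := (fine (root0_prob Z t)).

Lemma prob_jump (s : nat) (B : set nat) :
  P (Z s @^-1` B) = P (Z 0%N @^-1` B).
Proof. exact: (Zid s 0%N). Qed.

Lemma prob_eqE j : P (Z 0%N @^-1` [set j]) = (q j)%:E.
Proof. by rewrite fineK// fin_num_measure//; exact: measurable_RV_nat. Qed.

Lemma root0_probE t : P (root0 Z t) = (r t)%:E.
Proof. by rewrite fineK// fin_num_measure//; exact: measurable_root0. Qed.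

Lemma prob_leaf t n : (t <= n)%N ->
  P (leaf t n) = (r t * \prod_(j < n - t) (1 - q j.+1))%:E.
Proof.
move=> tn; rewrite root0_indep// EFinM root0_probE; congr (_ * _).
rewrite -{1}[t]add0n big_addn big_mkord -prodEFin; apply: eq_bigr => j _.
rewrite prob_jump subSn ?leq_addl// addnK -preimage_setC probability_setC.
  by rewrite prob_eqE.
exact: measurable_RV_nat.
Qed.

Lemma root0_prob0 : r 0 = 1%R.
Proof.
by apply: EFin_inj; rewrite -root0_probE root0_0 probability_setT.
Qed.

Lemma root0_probS t : r t.+1 = (\sum_(k < t.+1) r k * q (t.+1 - k))%R.
Proof.
apply: EFin_inj; rewrite -root0_probE root0_renewal// -sumEFin.
by apply: eq_bigr => k _; rewrite prob_jump prob_eqE root0_probE EFinM.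
Qed.

Lemma root0_prob_bounds t : (0 <= r t <= 1)%R.
Proof.
rewrite -!lee_fin -root0_probE measure_ge0/=.
by apply: probability_le1; exact: measurable_root0.
Qed.

Lemma mean_leaves_ratio n :
  'E_P[(fun w => (leaves Z n w)%:R : R)] / mean_size Z n =
  (\sum_(t < n) r t.+1 * \prod_(j < n - t.+1) (1 - q j.+1))%:E /
  (\sum_(t < n) r t.+1)%:E.
Proof.
rewrite expectation_leaves /mean_size big_add1 big_mkord -!sumEFin.
congr (_ / _); apply: eq_bigr => t _; first exact: prob_leaf.
exact: root0_probE.
Qed.

End mean_leaves.

(** * The law of one jump *)

Section jump_tail.
Context (d : measure_display) (T : measurableType d) (R : realType).
Context (P : probability T R) (X : {RV P >-> nat}).
Context (Xpos : forall w, (0 < X w)%N).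

Definition tail_prob (m : nat) : R := fine (P (X @^-1` [set k | (m < k)%N])).

Lemma tail_probE m : P (X @^-1` [set k | (m < k)%N]) = (tail_prob m)%:E.
Proof. by rewrite fineK// fin_num_measure//; exact: measurable_RV_nat. Qed.

Lemma tail_prob0 : tail_prob 0 = 1.
Proof.
apply: EFin_inj; rewrite -tail_probE -(probability_setT P); congr (P _).
by apply/seteqP; split => // w _; exact: Xpos.
Qed.

Lemma tail_probS m : tail_prob m.+1 = tail_prob m - prob_eq X m.+1.
Proof.
apply/eqP; rewrite eq_sym subr_eq; apply/eqP/EFin_inj.
rewrite EFinD -!tail_probE /prob_eq fineK; last first.
  by rewrite fin_num_measure//; exact: measurable_RV_nat.
rewrite -measureU; try exact: measurable_RV_nat.
  congr (P _); apply/seteqP; split => w /=.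
    by rewrite leq_eqVlt => /orP[/eqP|]; [right|left].
  by case=> [/ltnW//|->].
by apply/seteqP; split => // w /= [] /[swap] ->; rewrite ltnn.
Qed.

Lemma tail_prob_ge0 m : 0 <= tail_prob m.
Proof. by rewrite fine_ge0. Qed.

Lemma cvg_tail_prob0 : tail_prob @ \oo --> (0 : R).
Proof.
apply: fine_cvg.
pose F m := X @^-1` [set k | (m < k)%N].
have F0 : \bigcap_m F m = set0.
  by apply/seteqP; split=> // w /(_ (X w) I); rewrite /F /= ltnn.
have mF m : measurable (F m) by exact: measurable_RV_nat.
rewrite -[X in _ --> X](measure0 P) -F0; apply: nonincreasing_cvg_mu => //.
- by apply: (le_lt_trans (probability_le1 _ (mF _))); rewrite ltry.
- by rewrite F0.
- by move=> m n mn; apply/subsetPset => w; exact: leq_ltn_trans.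
Qed.

Lemma cvg_series_prob_eq : series (fun j => prob_eq X j.+1) @ \oo --> (1 : R).
Proof.
have E m : series (fun j => prob_eq X j.+1) m = 1 - tail_prob m.
  elim: m => [|m IH]; first by rewrite /series /= big_geq// tail_prob0 subrr.
  by rewrite seriesSr IH tail_probS opprB addrA addrAC.
rewrite (funext E) -[X in _ --> X]subr0.
by apply: cvgB; [exact: cvg_cst | exact: cvg_tail_prob0].
Qed.

(** Since [qmax] is attained, qmax >= 1 would make X almost surely equal to some
n, hence of mean n. *)
Lemma qmax_lt1 : 'E_P[(fun w => (X w)%:R : R)]%E = +oo%E -> qmax X < 1.
Proof.
move=> EX; have [[n _ qn] _] := qmax_attained Xpos.
rewrite ltNge; apply/negP; rewrite -qn => q1.
have mn : measurable (X @^-1` [set n]) by exact: measurable_RV_nat.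
have Pn : P (X @^-1` [set n]) = 1%E.
  apply/eqP; rewrite eq_le probability_le1//=.
  by rewrite -[leRHS]fineK ?fin_num_measure// lee_fin.
have PC : P (~` (X @^-1` [set n])) = 0%E.
  by rewrite probability_setC// Pn subee.
have aeX : ae_eq P setT (fun w => ((X w)%:R : R)%:E) (cst n%:R%:E).
  exists (~` (X @^-1` [set n])); split; first exact: measurableC.
    exact: PC.
  by move=> w /= H Xw; apply: H => _; have -> : X w = n by [].
move: EX; rewrite unlock (ae_eq_integral _ _ _ _ _ aeX)//.
  by rewrite integral_cst//= probability_setT mule1.
apply/measurable_EFinP.
by apply: (measurableT_comp _ (measurable_funP X)).
Qed.
End jump_tail.

(** * The ratio of the means *)

(* Z 0 is the generic copy of the jumps Z 1, Z 2, ... *)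
Theorem proposition3 (d : measure_display) (T : measurableType d)
    (R : realType) (P : probability T R) (Z : nat -> {RV P >-> nat})
    (Zpos : forall n w, (0 < Z n w)%N)
    (Zindep : mutually_independent Z)
    (Zid : identically_distributed Z)
    (EZ : 'E_P[(fun w => (Z 0%N w)%:R : R)]%E = +oo%E) :
  exists c : R,
    expR (- (1 / (1 - qmax (Z 0%N)))) <= c <= expR (- 1) /\
    (fun n : nat =>
       ('E_P[(fun w => (leaves Z n w)%:R : R)] / mean_size Z n)%E) @ \oo
      --> c%:E.
Proof.
pose q := prob_eq (Z 0%N); pose r t := fine (root0_prob Z t).
have q_bounds j : 0 <= q j.+1 <= qmax (Z 0%N).
  by rewrite fine_ge0//= (qmax_attained (Zpos 0%N)).2.
have [c [c_bounds p_cvg]] := cvg_prod_1B (qmax_lt1 (Zpos 0%N) EZ) q_bounds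
  (cvg_series_prob_eq (Zpos 0%N)).
exists c; split=> //.
have r_bounds t : 0 <= r t <= 1 by exact: root0_prob_bounds.
(* The mean size leaves out the root, that is, the term r 0 = 1. *)
have Roo : \sum_(t < n) r t.+1 @[n --> \oo] --> +oo.
  have Soo := renewal_cvg_pinfty (tail_prob0 (Zpos 0%N)) (tail_probS (Z 0%N))
    (root0_prob0 Zpos) (root0_probS Zpos Zindep Zid)
    (fun t => (andP (r_bounds t)).1)
    (tail_prob_ge0 (Z 0%N)) (cvg_tail_prob0 (Z 0%N)).
  apply/cvgryPge => A; near=> n.
  have : A + 1 <= \sum_(k < n.+1) r k.
    by near: n; move/cvgryPge : Soo; apply.
  by rewrite big_ord_recl /r (root0_prob0 Zpos) addrC lerD2l.
have ratio_cvg := cvg_weighted_mean (fun t => r_bounds t.+1) Roo p_cvg.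
have ratioE : \forall n \near \oo,
    ('E_P[(fun w => (leaves Z n w)%:R : R)] / mean_size Z n)%E =
    ((\sum_(t < n) r t.+1 * \prod_(j < n - t.+1) (1 - q j.+1)) /
      (\sum_(t < n) r t.+1))%:E.
  near=> n; rewrite mean_leaves_ratio// inver gt_eqF//.
  by near: n; move/cvgryPgt : Roo; apply.
apply: cvg_EFin; first by apply: filterS ratioE => n ->.
apply: cvg_trans ratio_cvg; apply: near_eq_cvg.
by apply: filterS ratioE => n /= ->.
Unshelve. all: end_near. Qed.
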